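(* Let $\lambda,\mu\in\mathbb F$. Then the pair $T_{\lambda\mu}=(V,\rho_{\lambda\mu})$ is a module of the 3-Lie algebra $A_\omega^\delta$ if and only if $\mu=0$ or $\mu=1$. Moreover, in the case $\mu=0$ or $\mu=1$: 1) $T_{\lambda\mu}$ is a reducible module with submodules $U(\alpha)=\sum_{m\in\mathbb Z}\mathbb F v_{\alpha+m}$ for all $\alpha\in\mathbb F$; 2) if $\mu=0$, then $\mathbb F v_{-\lambda}$ is a trivial submodule of $U(-\lambda)$; 3) if $\mu=1$, $\alpha\in\mathbb F$ and $\alpha+\lambda\in\mathbb Z$, then $\overline{U_\alpha}=\sum_{m\in\mathbb Z,\ m\neq-\lambda-\alpha}\mathbb F v_{\alpha+m}$ is an irreducible submodule of $U(\alpha)$; 4) for $\alpha\in\mathbb F$, $U(\alpha)$ is irreducible if and only if $\alpha+\lambda\notin\mathbb Z$.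
   Context: $\mathbb F$ is a field of characteristic zero (so $\mathbb Z\subset\mathbb F$); all vector spaces and algebras are over $\mathbb F$. A 3-Lie algebra is a vector space $B$ with a linear map $[\,,\,,\,]:B\wedge B\wedge B\to B$ satisfying $[x_1,x_2,[x_3,x_4,x_5]]=[[x_1,x_2,x_3],x_4,x_5]+[x_3,[x_1,x_2,x_4],x_5]+[x_3,x_4,[x_1,x_2,x_5]]$ for all $x_i\in B$. A module (representation) of a 3-Lie algebra $B$ is a pair $(W,\rho)$, where $W$ is a vector space and $\rho:B\wedge B\to gl(W)$ is linear, such that for all $x_1,x_2,x_3,x_4\in B$: $[\rho(x_1,x_2),\rho(x_3,x_4)]=\rho([x_1,x_2,x_3],x_4)+\rho(x_3,[x_1,x_2,x_4])$ and $\rho([x_1,x_2,x_3],x_4)=\rho(x_1,x_2)\rho(x_3,x_4)+\rho(x_2,x_3)\rho(x_1,x_4)+\rho(x_3,x_1)\rho(x_2,x_4)$. A submodule is a subspace stable under all $\rho(x,y)$; a module is irreducible if it has no submodules other than $0$ and itself, and reducible otherwise; a trivial submodule is one on which all $\rho(x,y)$ act as zero. $A_\omega^\delta$ is the (simple) 3-Lie algebra with basis $\{L_r,M_r\mid r\in\mathbb Z\}$ and (skew-symmetric) bracket determined by $[L_r,L_s,M_t]=(s-r)L_{r+s-t}$, $[L_r,M_s,M_t]=(t-s)M_{s+t-r}$ for $r,s,t\in\mathbb Z$, all other brackets of basis elements (i.e. $[L_r,L_s,L_t]$ and $[M_r,M_s,M_t]$) being zero. $V=\sum_{\alpha\in\mathbb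 F}\mathbb F v_\alpha$ is the vector space with basis $\{v_\alpha\mid\alpha\in\mathbb F\}$. For $\lambda,\mu\in\mathbb F$, the linear map $\rho_{\lambda\mu}:A_\omega^\delta\wedge A_\omega^\delta\to gl(V)$ is defined, for $r,s\in\mathbb Z$ and $\alpha\in\mathbb F$, by $\rho_{\lambda\mu}(L_r,M_s)v_\alpha=(\lambda+\alpha+(s-r)\mu)v_{\alpha+s-r}$, $\rho_{\lambda\mu}(L_r,L_s)v_\alpha=0$, $\rho_{\lambda\mu}(M_r,M_s)v_\alpha=0$. *)

(* Defs.v *)
From HB Require Import structures.
From mathcomp Require Import all_boot all_order all_algebra.
From mathcomp Require Import classical_sets.
From mathcomp Require Import freeg.
From mathcomp Require Import ring.

Set Implicit Arguments.
Unset Strict Implicit.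
Unset Printing Implicit Defensive.

Import GRing.Theory.

Local Open Scope classical_set_scope.
Local Open Scope ring_scope.

(* A linear map out of B /\ B /\ B is a trilinear map on B that vanishes as   *)
(* soon as two of its arguments are equal.                                    *)
HB.mixin Record Lmodule_isThreeLie (F : fieldType) B of GRing.Lmodule F B := {
  br : B -> B -> B -> B;
  br_linear1 : forall y z, linear (fun x => br x y z);
  br_linear2 : forall x z, linear (fun y => br x y z);
  br_linear3 : forall x y, linear (fun z => br x y z);
  br_alt12 : forall x z, br x x z = 0;
  br_alt13 : forall x y, br x y x = 0;
  br_alt23 : forall x y, br x y y = 0;
  br_fundamental : forall x1 x2 x3 x4 x5,
    br x1 x2 (br x3 x4 x5) =
      br (br x1 x2 x3) x4 x5 + br x3 (br x1 x2 x4) x5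
        + br x3 x4 (br x1 x2 x5)
}.

#[short(type="threeLieType")]
HB.structure Definition ThreeLie (F : fieldType) :=
  { B of GRing.Lmodule F B & Lmodule_isThreeLie F B }.

Section Modules.
Variables (F : fieldType) (B : threeLieType F) (W : lmodType F).
Variable rho : B -> B -> {linear W -> W}.

(* (W, rho) is a module of B. The first three fields say that rho is a linear *)
(* map B /\ B -> gl(W), with equalities in gl(W) stated pointwise.            *)
Record is_module : Prop := IsModule {
  module_linear1 : forall y w, linear (fun x => rho x y w);
  module_linear2 : forall x w, linear (fun y => rho x y w);
  module_alt : forall x w, rho x x w = 0;
  module_comm : forall x1 x2 x3 x4 w,
    rho x1 x2 (rho x3 x4 w) - rho x3 x4 (rho x1 x2 w) =
      rho (br x1 x2 x3) x4 w + rho x3 (br x1 x2 x4) w;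
  module_br : forall x1 x2 x3 x4 w,
    rho (br x1 x2 x3) x4 w =
      rho x1 x2 (rho x3 x4 w) + rho x2 x3 (rho x1 x4 w)
        + rho x3 x1 (rho x2 x4 w)
}.

Record is_submodule (S : set W) : Prop := IsSubmodule {
  submodule0 : S 0;
  submodule_lin : forall a u v, S u -> S v -> S (a *: u + v);
  submodule_stable : forall x y w, S w -> S (rho x y w)
}.

Definition submodule_of (S U : set W) : Prop := is_submodule S /\ S `<=` U.

Definition trivial_submodule_of (S U : set W) : Prop :=
  submodule_of S U /\ forall x y w, S w -> rho x y w = 0.

(* Irreducibility of a submodule U of W, seen as a module under the restricted *)
(* action: its submodules are the submodules of W contained in U.             *)
Definition irreducible (U : set W) : Prop :=
  forall S, submodule_of S U -> S = [set 0] \/ S = U.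

Definition reducible_module : Prop := is_module /\ ~ irreducible setT.

End Modules.

Section Span.
Variables (F : fieldType) (V : lmodType F).

(* The sum of the lines F u for u in X. *)
Definition lspan (X : set V) : set V :=
  [set v | exists (s : seq V) (c : V -> F),
     (forall u, u \in s -> X u) /\ v = \sum_(u <- s) c u *: u].

End Span.

Section FreeLift.
Variables (F : fieldType) (K : choiceType).

Lemma fglift_linear (M : lmodType F) (f : K -> M) :
  linear (fglift f : {freeg K / F} -> M).
Proof.
have addf : {morph (fglift f : {freeg K / F} -> M) : x y / x + y}.
  move=> x y; have subf := lift_is_additive f.
  have f0 : fglift f (0 : {freeg K / F}) = 0 by rewrite -(subr0 0) subf subrr.
  by rewrite -[y in LHS]opprK subf -[- y]sub0r subf f0 sub0r opprK.
move=> a x y; rewrite addf; congr (_ + _).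
have -> : a *: x = \sum_(z <- dom x) << a * coeff z x *g z >> by [].
rewrite -{3}[x]freeg_sumE.
have f0 : fglift f (0 : {freeg K / F}) = 0.
  by apply: (addrI (fglift f 0)); rewrite -addf !addr0.
rewrite !(big_morph (fglift f) addf f0) scaler_sumr.
by apply: eq_bigr => i _; rewrite !liftU scalerA.
Qed.

HB.instance Definition _ (M : lmodType F) (f : K -> M) :=
  GRing.isLinear.Build F {freeg K / F} M *:%R (fglift f) (fglift_linear f).

Lemma freeg_linear_ext (M : lmodType F) (f g : {freeg K / F} -> M) :
  linear f -> linear g -> (forall k, f << k >> = g << k >>) -> f =1 g.
Proof.
move=> lf lg fg; have l0 h : linear h -> h (0 : {freeg K / F}) = 0 :> M.
  by move=> lh; have := lh (-1) 0 0; rewrite scaleN1r addr0 oppr0 scaleN1r addNr.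
elim/freeg_ind_dom0 => [|k x D _ _ IH]; first by rewrite !l0.
have -> : << k *g x >> = k *: << x >> :> {freeg K / F}.
  by apply/eqP/freeg_eqP => z; rewrite coeffZ !coeffU mul1r.
by rewrite lf lg fg IH.
Qed.

Lemma fglift_linear_param (M N : lmodType F)
    (f : K -> M -> N) (x : {freeg K / F}) :
  (forall k, linear (f k)) -> linear (fun m => fglift (fun k => f k m) x).
Proof.
move=> lf a u v; move: x; apply: freeg_linear_ext.
- exact: fglift_linear.
- move=> b x y; rewrite !fglift_linear !scalerDr !scalerA (mulrC a b) addrACA.
  done.
- by move=> k; rewrite !liftU !scale1r lf.
Qed.

End FreeLift.

Section Algebra.
Variable F : fieldType.

(* inl r indexes the basis vector L_r and inr r the basis vector M_r. *)
Definition Aod := {freeg (int + int)%type / F}.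
HB.instance Definition _ := GRing.Lmodule.on Aod.

Definition Lb (r : int) : Aod := << inl r >>.
Definition Mb (r : int) : Aod := << inr r >>.

(* The skew-symmetric completion of the two defining families of brackets    *)
(* [L_r, L_s, M_t] and [L_r, M_s, M_t].                                       *)
Definition br_basis (i j k : int + int) : Aod :=
  match i, j, k with
  | inl r, inl s, inr t =>   (s - r)%:~R *: Lb (r + s - t)
  | inl r, inr t, inl s => - ((s - r)%:~R *: Lb (r + s - t))
  | inr t, inl r, inl s =>   (s - r)%:~R *: Lb (r + s - t)
  | inl r, inr s, inr t =>   (t - s)%:~R *: Mb (s + t - r)
  | inr s, inl r, inr t => - ((t - s)%:~R *: Mb (s + t - r))
  | inr s, inr t, inl r =>   (t - s)%:~R *: Mb (s + t - r)
  | inl _, inl _, inl _ => 0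
  | inr _, inr _, inr _ => 0
  end.

Definition Aod_br (x y z : Aod) : Aod :=
  fglift (fun i => fglift (fun j => fglift (fun k => br_basis i j k) z) y) x.

Lemma Aod_br_linear1 y z : linear (fun x => Aod_br x y z).
Proof. exact: fglift_linear. Qed.

Lemma Aod_br_linear2 x z : linear (fun y => Aod_br x y z).
Proof. by apply: fglift_linear_param => k; exact: fglift_linear. Qed.

Lemma Aod_br_linear3 x y : linear (fun z => Aod_br x y z).
Proof.
apply: fglift_linear_param => k; apply: fglift_linear_param => l.
exact: fglift_linear.
Qed.

Lemma Aod_br_basisE i j k : Aod_br << i >> << j >> << k >> = br_basis i j k.
Proof. by rewrite /Aod_br !liftU !scale1r. Qed.


Lemma Aod_br_ext (M : lmodType F) (f g : Aod -> M) :
  linear f -> linear g -> (forall i, f << i >> = g << i >>) -> f =1 g.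
Proof. exact: freeg_linear_ext. Qed.

Lemma br_basisCl i j k : br_basis i j k = - br_basis j i k.
Proof.
case: i j k => i [] j [] k /=; rewrite ?oppr0 ?opprK -?scaleNr //;
  (congr (_ *: << _ >>); [ring | congr (_ _); ring]).
Qed.

Lemma br_basisCr i j k : br_basis i j k = - br_basis i k j.
Proof.
case: i j k => i [] j [] k /=; rewrite ?oppr0 ?opprK -?scaleNr //;
  (congr (_ *: << _ >>); [ring | congr (_ _); ring]).
Qed.

Let l0 (M : lmodType F) (f : Aod -> M) : linear f -> f 0 = 0.
Proof.
by move=> lh; have := lh (-1) 0 0; rewrite scaleN1r addr0 oppr0 scaleN1r addNr.
Qed.

Let lZ (M : lmodType F) (f : Aod -> M) a x : linear f -> f (a *: x) = a *: f x.
Proof. by move=> lf; have := lf a x 0; rewrite (l0 lf) !addr0. Qed.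

Let linearN (M : lmodType F) (f : Aod -> M) : linear f -> linear (\- f).
Proof. by move=> lf a x y; rewrite /= lf opprD scalerN. Qed.

Let linearS (M : lmodType F) (f g : Aod -> M) :
  linear f -> linear g -> linear (f \+ g).
Proof. by move=> lf lg a x y; rewrite /= lf lg scalerDr addrACA. Qed.

Lemma Aod_brCl x y z : Aod_br x y z = - Aod_br y x z.
Proof.
move: x; apply: Aod_br_ext; first exact: Aod_br_linear1.
  exact: linearN (Aod_br_linear2 y z).
move=> i; move: y; apply: Aod_br_ext; first exact: Aod_br_linear2.
  exact: linearN (Aod_br_linear1 _ z).
move=> j; move: z; apply: Aod_br_ext; first exact: Aod_br_linear3.
  exact: linearN (Aod_br_linear3 _ _).
by move=> k; rewrite !Aod_br_basisE br_basisCl.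
Qed.

Lemma Aod_brCr x y z : Aod_br x y z = - Aod_br x z y.
Proof.
move: x; apply: Aod_br_ext; first exact: Aod_br_linear1.
  exact: linearN (Aod_br_linear1 z y).
move=> i; move: y; apply: Aod_br_ext; first exact: Aod_br_linear2.
  exact: linearN (Aod_br_linear3 _ z).
move=> j; move: z; apply: Aod_br_ext; first exact: Aod_br_linear3.
  exact: linearN (Aod_br_linear2 _ _).
by move=> k; rewrite !Aod_br_basisE br_basisCr.
Qed.

Lemma Aod_br_alt12 x z : Aod_br x x z = 0.
Proof.
elim/freeg_ind_dom0: x => [|a i x _ _ IH].
  exact: l0 (Aod_br_linear1 _ _).
have -> : << a *g i >> = a *: << i >> :> Aod.
  by apply/eqP/freeg_eqP => u; rewrite coeffZ !coeffU mul1r.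
rewrite Aod_br_linear1 !Aod_br_linear2 IH addr0 [Aod_br x _ _]Aod_brCl scalerN.
have -> : Aod_br << i >> << i >> z = 0; last by rewrite scaler0 add0r subrr.
move: z {IH}; apply: Aod_br_ext; first exact: Aod_br_linear3.
  by move=> b u v; rewrite scaler0 addr0.
move=> k; rewrite Aod_br_basisE.
by case: i k => r [] k //=; rewrite subrr scale0r.
Qed.

Lemma Aod_br_alt23 x y : Aod_br x y y = 0.
Proof. by rewrite Aod_brCl Aod_brCr opprK Aod_br_alt12. Qed.

Lemma Aod_br_alt13 x y : Aod_br x y x = 0.
Proof. by rewrite Aod_brCr Aod_br_alt12 oppr0. Qed.

Let sum4 (z : int + int) (a b c d : F) (i j k l : int + int) :
  (a = 0 \/ i = z) -> (b = 0 \/ j = z) -> (c = 0 \/ k = z) ->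
  (d = 0 \/ l = z) -> a = b + c + d ->
  a *: << i >> = b *: << j >> + c *: << k >> + d *: << l >> :> Aod.
Proof.
have P (e : F) t : (e = 0 \/ t = z) -> e *: << t >> = e *: << z >> :> Aod.
  by move=> [->|->]; rewrite ?scale0r.
by move=> /P-> /P-> /P-> /P-> ->; rewrite !scalerDl.
Qed.

Let br_coef (i j k : int + int) : F :=
  match i, j, k with
  | inl r, inl s, inr t =>   (s - r)%:~R
  | inl r, inr t, inl s => - (s - r)%:~R
  | inr t, inl r, inl s =>   (s - r)%:~R
  | inl r, inr s, inr t =>   (t - s)%:~R
  | inr s, inl r, inr t => - (t - s)%:~R
  | inr s, inr t, inl r =>   (t - s)%:~R
  | _, _, _ => 0
  end.

Let br_index (i j k : int + int) : int + int :=
  match i, j, k with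
  | inl r, inl s, inr t => inl (r + s - t)
  | inl r, inr t, inl s => inl (r + s - t)
  | inr t, inl r, inl s => inl (r + s - t)
  | inl r, inr s, inr t => inr (s + t - r)
  | inr s, inl r, inr t => inr (s + t - r)
  | inr s, inr t, inl r => inr (s + t - r)
  | _, _, _ => i
  end.

Let br_basisE i j k : br_basis i j k = br_coef i j k *: << br_index i j k >>.
Proof. by case: i j k => i [] j [] k /=; rewrite ?scale0r ?scaleNr. Qed.

Let fundamental_basis i1 i2 i3 i4 i5 :
  let b i : Aod := << i >> in
  Aod_br (b i1) (b i2) (Aod_br (b i3) (b i4) (b i5)) =
    Aod_br (Aod_br (b i1) (b i2) (b i3)) (b i4) (b i5)
      + Aod_br (b i3) (Aod_br (b i1) (b i2) (b i4)) (b i5)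
      + Aod_br (b i3) (b i4) (Aod_br (b i1) (b i2) (b i5)).
Proof.
move=> b; rewrite /b {b} !(Aod_br_basisE, br_basisE).
rewrite !(lZ _ _ (Aod_br_linear1 _ _), lZ _ _ (Aod_br_linear2 _ _),
          lZ _ _ (Aod_br_linear3 _ _)).
rewrite !(Aod_br_basisE, br_basisE) !scalerA.
case: i1 i2 i3 i4 i5 => i1 [] i2 [] i3 [] i4 [] i5 /=;
match goal with |- ?a *: << ?i >> = ?b *: << ?j >> + ?c *: << ?k >> + ?d *: << ?l >> =>
  let fin := solve [left; ring | right; congr (_ _); ring | ring] in
  first [ solve [apply: (@sum4 i); fin] | solve [apply: (@sum4 j); fin]
        | solve [apply: (@sum4 k); fin] | solve [apply: (@sum4 l); fin]]
end.
Qed.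

Lemma Aod_br_fundamental x1 x2 x3 x4 x5 :
  Aod_br x1 x2 (Aod_br x3 x4 x5) =
    Aod_br (Aod_br x1 x2 x3) x4 x5 + Aod_br x3 (Aod_br x1 x2 x4) x5
      + Aod_br x3 x4 (Aod_br x1 x2 x5).
Proof.
have E a (A B C A' B' C' : Aod) : (a *: A + A') + (a *: B + B') + (a *: C + C')
    = a *: (A + B + C) + (A' + B' + C').
  by rewrite !scalerDr [a *: A + A' + _]addrACA [LHS]addrACA.
move: x1; apply: Aod_br_ext => [a u v|a u v|i1];
  rewrite ?(Aod_br_linear1, Aod_br_linear2, Aod_br_linear3) ?E //.
move: x2; apply: Aod_br_ext => [a u v|a u v|i2];
  rewrite ?(Aod_br_linear1, Aod_br_linear2, Aod_br_linear3) ?E //.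
move: x3; apply: Aod_br_ext => [a u v|a u v|i3];
  rewrite ?(Aod_br_linear1, Aod_br_linear2, Aod_br_linear3) ?E //.
move: x4; apply: Aod_br_ext => [a u v|a u v|i4];
  rewrite ?(Aod_br_linear1, Aod_br_linear2, Aod_br_linear3) ?E //.
move: x5; apply: Aod_br_ext => [a u v|a u v|i5];
  rewrite ?(Aod_br_linear1, Aod_br_linear2, Aod_br_linear3) ?E //.
Qed.

HB.instance Definition _ := Lmodule_isThreeLie.Build F Aod
  Aod_br_linear1 Aod_br_linear2 Aod_br_linear3
  Aod_br_alt12 Aod_br_alt13 Aod_br_alt23 Aod_br_fundamental.

Lemma br_LLM r s t : br (Lb r) (Lb s) (Mb t) = (s - r)%:~R *: Lb (r + s - t).
Proof. exact: Aod_br_basisE. Qed.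

Lemma br_LMM r s t : br (Lb r) (Mb s) (Mb t) = (t - s)%:~R *: Mb (s + t - r).
Proof. exact: Aod_br_basisE. Qed.

Lemma br_LLL r s t : br (Lb r) (Lb s) (Lb t) = 0.
Proof. exact: Aod_br_basisE. Qed.

Lemma br_MMM r s t : br (Mb r) (Mb s) (Mb t) = 0.
Proof. exact: Aod_br_basisE. Qed.

End Algebra.

Section TModules.
Variables (F : fieldType) (lam mu : F).

Definition V := {freeg F / F}.
HB.instance Definition _ := GRing.Lmodule.on V.

Definition vb (alpha : F) : V := << alpha >>.

Definition rho_basis (i j : int + int) (alpha : F) : V :=
  match i, j with
  | inl r, inr s =>
      (lam + alpha + (s - r)%:~R * mu) *: vb (alpha + (s - r)%:~R)
  | inr s, inl r =>
      - ((lam + alpha + (s - r)%:~R * mu) *: vb (alpha + (s - r)%:~R))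
  | inl _, inl _ => 0
  | inr _, inr _ => 0
  end.

Definition rho_fun (x y : Aod F) (w : V) : V :=
  fglift (fun i => fglift (fun j => fglift (rho_basis i j) w) y) x.

Lemma rho_fun_linear x y : linear (rho_fun x y).
Proof.
apply: fglift_linear_param => i; apply: fglift_linear_param => j.
exact: fglift_linear.
Qed.

HB.instance Definition _ x y :=
  GRing.isLinear.Build F V V *:%R (rho_fun x y) (rho_fun_linear x y).

Definition rhoT (x y : Aod F) : {linear V -> V} := rho_fun x y.

Lemma rhoT_LM r s alpha : rhoT (Lb F r) (Mb F s) (vb alpha) =
  (lam + alpha + (s - r)%:~R * mu) *: vb (alpha + (s - r)%:~R).
Proof. by rewrite /= /rho_fun !liftU !scale1r. Qed.

Lemma rhoT_LL r s alpha : rhoT (Lb F r) (Lb F s) (vb alpha) = 0.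
Proof. by rewrite /= /rho_fun !liftU !scale1r. Qed.

Lemma rhoT_MM r s alpha : rhoT (Mb F r) (Mb F s) (vb alpha) = 0.
Proof. by rewrite /= /rho_fun !liftU !scale1r. Qed.

End TModules.

Section Subspaces.
Variable F : fieldType.

(* x lies in the image of Z in F. *)
Definition inZ (x : F) : Prop := exists m : int, x = m%:~R.

Definition U (alpha : F) : set (V F) :=
  lspan [set vb (alpha + m%:~R) | m in [set: int]].

Definition Ubar (lam alpha : F) : set (V F) :=
  lspan [set vb (alpha + m%:~R) | m in [set m : int | m%:~R != - lam - alpha]].

End Subspaces.

(* Main.v *)
Require Import Defs.
From HB Require Import structures.
From mathcomp Require Import all_boot all_order all_algebra.
From mathcomp Require Import classical_sets boolp freeg.
From mathcomp Require Import ring zify.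

(** On the basis, [rho (L_r, M_s)] is the weight-shifting operator
    [D_n v_b = (lam + b + n mu) v_(b+n)] with [n = s - r], and all other pairs
    act by zero up to skew-symmetry.

    Module axioms.  For every [mu] one has [[D_n, D_m] = (m - n) D_(n+m)], the
    relation of tensor density modules over the Witt algebra, and this is the
    commutator axiom ([rhoT_comm]).  The second axiom amounts to
    [D_p D_q - D_p' D_q' = (p - p') D_(p+q)] whenever [p + q = p' + q'].  The
    two sides, evaluated at [v_b], have coefficients that differ by
    [(mu - mu^2) (p - p') (p' - q)]: so it holds when [mu] is 0 or 1
    ([rhoT_br]), and one instance in which the other two factors are 1 forces
    [mu = mu^2] ([rhoT_is_module]).

    Submodules.  The operator [D_0] is diagonal with the pairwise distinct
    eigenvalues [lam + b], so a submodule contains [v_b] as soon as one of its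
    vectors has a nonzero coordinate at [b] ([submodule_vb]).  Submodules are
    therefore spanned by weight vectors: they are the spaces of vectors
    supported on a set of weights closed under the shifts whose coefficient
    [lam + b + n mu] is nonzero ([supported_submodule]), and such a space is
    irreducible when any of its weights reaches any other by a single shift with
    nonzero coefficient ([supported_irreducible]).  The statement then becomes a
    question on the coefficient.  For [mu = 0] it is [lam + b], which depends on
    the source only and vanishes at [b = - lam]: this weight cannot be left.
    For [mu = 1] it is [lam + (b + n)], which depends on the target only: the
    weight [- lam] cannot be entered.  A coset of the integers is thus
    irreducible exactly when it misses [- lam]. *)

Set Implicit Arguments.
Unset Strict Implicit.
Unset Printing Implicit Defensive.

Import GRing.Theory.

Local Open Scope classical_set_scope.
Local Open Scope ring_scope.

(** * Linear functions on free modules *)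

Section LinearFunctions.
Variables (F : fieldType) (M N : lmodType F) (f : M -> N).
Hypothesis lf : linear f.

Lemma linear_fun0 : f 0 = 0.
Proof.
by have := lf (-1) 0 0; rewrite scaleN1r addr0 oppr0 scaleN1r addNr.
Qed.

Lemma linear_funZ a x : f (a *: x) = a *: f x.
Proof. by have := lf a x 0; rewrite linear_fun0 !addr0. Qed.

End LinearFunctions.

Section FreeModules.
Variables (F : fieldType) (K : choiceType).

Lemma coeff_linear (k : K) : linear (coeff k : {freeg K / F} -> F^o).
Proof. by move=> a u v; rewrite coeffD coeffZ. Qed.

Lemma freegUZ a (k : K) : << a *g k >> = a *: << k >> :> {freeg K / F}.
Proof. by apply/eqP/freeg_eqP => z; rewrite coeffZ !coeffU mul1r. Qed.

(** Tracking the coordinates that occur in [x] is what lets a condition on the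
    support of a vector be used for its image. *)
Lemma fglift_closed (M : lmodType F) (S : set M) (f : K -> M)
    (x : {freeg K / F}) :
  S 0 -> (forall a u v, S u -> S v -> S (a *: u + v)) ->
  (forall k, coeff k x != 0 -> S (f k)) -> S (fglift f x).
Proof.
move=> S0 Slin Sf; rewrite -[x]freeg_sumE.
have: all (fun k => coeff k x != 0) (dom x).
  by apply/allP => k; rewrite mem_dom.
elim: (dom x) => [_|k s IH /= /andP[xk xs]].
  by rewrite big_nil (linear_fun0 (fglift_linear f)).
by rewrite big_cons freegUZ fglift_linear liftU scale1r; apply: Slin; auto.
Qed.

End FreeModules.

(** * Spans of weight vectors *)

Section WeightSpans.
Variable F : fieldType.
Implicit Types (P Q : set F) (w : V F).

Definition supported_on P : set (V F) :=
  [set w | forall b, coeff b w != 0 -> P b].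

(** Distinct weight vectors are linearly independent, so the spans in the
    theorem can be described by a condition on coordinates, which is easier to
    test. *)
Lemma lspan_vbE (I : Type) (f : I -> F) (X : set I) :
  lspan [set vb (f i) | i in X] = supported_on [set f i | i in X].
Proof.
apply/seteqP; split=> [w [s [c [sX ->]]] b|w wX].
  rewrite raddf_sum /= => nz.
  have /hasP[u us]: has (fun u => coeff b u != 0) s.
    apply: contra_neqT nz => /hasPn s0; rewrite big_seq big1 // => u /s0.
    by rewrite coeffZ negbK => /eqP ->; rewrite mulr0.
  have [i Xi <-] := sX _ us.
  by rewrite coeffU mul1r; case: (f i =P b) => [<- _|_ /eqP//]; exists i.
(* The coefficients of a span are functions of the vector: the index z is
   recovered from vb z as the only element of its support. *)
exists [seq vb z | z <- dom w], (fun u => coeff (head 0 (dom u)) w); split.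
  move=> u /mapP[z]; rewrite mem_dom => /wX[i Xi <-] ->; by exists i.
rewrite big_map -{1}[w]freeg_sumE.
by apply: eq_bigr => z _; rewrite /vb domU1 freegUZ.
Qed.

Lemma supported_vb P b : supported_on P (vb b) <-> P b.
Proof.
split=> [|Pb c]; first by apply; rewrite coeffU eqxx mul1r oner_eq0.
by rewrite coeffU mul1r; case: (b =P c) => [<-|_ /eqP].
Qed.

Lemma supported0 P : supported_on P 0.
Proof. by move=> b; rewrite coeff0 eqxx. Qed.

Lemma supported_lin P a u v :
  supported_on P u -> supported_on P v -> supported_on P (a *: u + v).
Proof.
move=> Pu Pv b; rewrite coeffD coeffZ.
by have [-> |/Pu//] := eqVneq (coeff b u) 0; rewrite mulr0 add0r; exact: Pv.
Qed.

Lemma supportedS P Q : P `<=` Q -> supported_on P `<=` supported_on Q.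
Proof. by move=> PQ w Pw b /Pw; exact: PQ. Qed.

End WeightSpans.

(** * The action and its submodules *)

Section Action.
Variables (F : fieldType) (lam mu : F).
Local Notation rho := (rhoT lam mu).

Lemma rhoT_linear1 y w : linear (fun x => rho x y w).
Proof. exact: fglift_linear. Qed.

Lemma rhoT_linear2 x w : linear (fun y => rho x y w).
Proof. by apply: fglift_linear_param => k; exact: fglift_linear. Qed.

Lemma rhoT_linear3 x y : linear (rho x y).
Proof. exact: rho_fun_linear. Qed.

Lemma rhoT_basisE i j b : rho << i >> << j >> (vb b) = rho_basis lam mu i j b.
Proof. by rewrite /= /rho_fun !liftU !scale1r. Qed.

Lemma supported_submodule (P : set F) :
  (forall b (n : int), P b -> lam + b + n%:~R * mu != 0 -> P (b + n%:~R)) ->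
  is_submodule rho (supported_on P).
Proof.
move=> PP; split; [exact: supported0 | exact: supported_lin | move=> x y w Pw].
have P0 := @supported0 _ P; have Plin := @supported_lin _ P.
apply: fglift_closed => // i _; apply: fglift_closed => // j _.
apply: fglift_closed => // b /Pw Pb.
(* The sign e covers the two orders of the arguments L_r, M_s. *)
have line e (n : int) :
    supported_on P ((e * (lam + b + n%:~R * mu)) *: vb (b + n%:~R)).
  rewrite -[X in supported_on P X]addr0.
  have [->|nz] := eqVneq (lam + b + n%:~R * mu) 0.
    by rewrite mulr0 scale0r addr0.
  by apply: Plin => //; apply/supported_vb/PP.
case: i j => i [] j //=; first by rewrite -[lam + _ + _]mul1r.
by rewrite -scaleNr -mulN1r.
Qed.

(** Projection onto an eigenline: on [w], the product of the operators
    [D_0 - (lam + z)] for [z] in the support of [w] other than [b] kills all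
    coordinates but the one at [b]. *)
Lemma submodule_vb S w b :
  is_submodule rho S -> S w -> coeff b w != 0 -> S (vb b).
Proof.
move=> [S0 Slin Sst] Sw wb.
have SZ a u : S u -> S (a *: u).
  by move=> Su; rewrite -[_ *: u]addr0; exact: Slin.
(* D_0 is diagonal. *)
have weight u c : coeff c (rho (Lb F 0) (Mb F 0) u) = (lam + c) * coeff c u.
  move: u; apply: (@freeg_linear_ext _ _ F^o).
  - by move=> a u v; rewrite rhoT_linear3 coeff_linear.
  - by move=> a u v; rewrite coeff_linear mulrDr mulrCA.
  - move=> k; rewrite rhoT_LM coeffZ /vb !coeffU subrr mul0r !addr0 !mul1r.
    by case: (k =P c) => [->|]; rewrite ?mulr0.
have prune s : exists2 u, S u &
    forall c, coeff c u = (\prod_(z <- s) (c - z)) * coeff c w.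
  elim: s => [|z s [u Su uE]].
    by exists w => // c; rewrite big_nil mul1r.
  exists (- (lam + z) *: u + rho (Lb F 0) (Mb F 0) u).
    by apply: Slin => //; exact: Sst.
  by move=> c; rewrite big_cons coeffD coeffZ weight uE; ring.
have [u Su uE] := prune (rem b (dom w)).
pose p := \prod_(z <- rem b (dom w)) (b - z).
have p0 : p != 0.
  rewrite prodf_seq_neq0; apply/allP => z.
  rewrite (rem_filter _ (uniq_dom w)) mem_filter /= subr_eq0 eq_sym.
  by case/andP.
have -> : vb b = (p * coeff b w)^-1 *: u; last exact: SZ.
apply/eqP/freeg_eqP => c; rewrite coeffZ uE coeffU mul1r.
have [<-|bc] := eqVneq b c; first by rewrite mulVf ?mulf_neq0.
have [cw|cw] := boolP (c \in dom w); last by rewrite (coeff_outdom cw) !mulr0.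
rewrite (big_rem c) /= ?subrr ?mul0r ?mulr0 //.
by rewrite (rem_filter _ (uniq_dom w)) mem_filter /= eq_sym bc.
Qed.

Lemma supported_irreducible (P : set F) :
  (forall b c, P b -> P c ->
     exists2 n : int, c = b + n%:~R & lam + b + n%:~R * mu != 0) ->
  irreducible rho (supported_on P).
Proof.
move=> Pconn S [subS SP]; have [S0 Slin Sst] := subS.
have [sub0|/existsNP[w /not_implyP[Sw /eqP w0]]] := pselect (S `<=` [set 0]).
  by left; apply/seteqP; split=> // _ ->.
right; apply/seteqP; split=> // u Pu.
have [b wb]: exists b, coeff b w != 0.
  apply/not_existsP => /= all0; case/eqP: w0; apply/eqP/freeg_eqP => b.
  by rewrite coeff0; apply/eqP; rewrite -[_ == _]negbK; apply/negP/all0.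
have Pb := SP _ Sw _ wb; have Sb := submodule_vb subS Sw wb.
have Sc c : P c -> S (vb c).
  move=> Pc; have [n -> nz] := Pconn _ _ Pb Pc.
  (* The shift by n is the action of L_0, M_n. *)
  have := Slin (lam + b + n%:~R * mu)^-1 _ _ (Sst (Lb F 0) (Mb F n) _ Sb) S0.
  by rewrite rhoT_LM subr0 scalerA mulVf // scale1r addr0.
have -> : u = fglift (@vb F) u.
  move: {Pu} u; apply: freeg_linear_ext => // [|k]; first exact: fglift_linear.
  by rewrite liftU scale1r.
by apply: fglift_closed => // c /Pu /Sc.
Qed.

Lemma supported_reducible (P Q : set F) b c :
  is_submodule rho (supported_on Q) -> Q `<=` P -> Q b -> P c -> ~ Q c ->
  ~ irreducible rho (supported_on P).
Proof.
move=> subQ QP Qb Pc nQc irr.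
have [Q0|QE] := irr _ (conj subQ (supportedS QP)).
  have := proj2 (supported_vb Q b) Qb; rewrite Q0 => /eqP.
  by rewrite /vb freegU_eq0 oner_eq0.
by apply: nQc; apply/supported_vb; rewrite QE; apply/supported_vb.
Qed.

(** * The module axioms *)

(** The bracket and the action send basis vectors to multiples of basis vectors.
    With coefficient and index as separate total functions, an identity between
    basis vectors splits into one between coefficients and several between
    indices. *)
Definition br_coef (i j k : int + int) : F :=
  match i, j, k with
  | inl r, inl s, inr t =>   (s - r)%:~R
  | inl r, inr t, inl s => - (s - r)%:~R
  | inr t, inl r, inl s =>   (s - r)%:~R
  | inl r, inr s, inr t =>   (t - s)%:~R
  | inr s, inl r, inr t => - (t - s)%:~R
  | inr s, inr t, inl r =>   (t - s)%:~R
  | _, _, _ => 0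
  end.

Definition br_index (i j k : int + int) : int + int :=
  match i, j, k with
  | inl r, inl s, inr t | inl r, inr t, inl s | inr t, inl r, inl s =>
      inl (r + s - t)
  | inl r, inr s, inr t | inr s, inl r, inr t | inr s, inr t, inl r =>
      inr (s + t - r)
  | _, _, _ => i
  end.

Lemma br_basisE i j k :
  @br F (Aod F) << i >> << j >> << k >> = br_coef i j k *: << br_index i j k >>.
Proof.
rewrite [LHS]Aod_br_basisE.
by case: i j k => i [] j [] k /=; rewrite ?scale0r ?scaleNr.
Qed.

Definition rho_coef (i j : int + int) (b : F) : F :=
  match i, j with
  | inl r, inr s => lam + b + (s - r)%:~R * mu
  | inr s, inl r => - (lam + b + (s - r)%:~R * mu)
  | _, _ => 0
  end.

Definition rho_index (i j : int + int) (b : F) : F :=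
  match i, j with
  | inl r, inr s | inr s, inl r => b + (s - r)%:~R
  | _, _ => b
  end.

Lemma rho_vbE i j b :
  rho << i >> << j >> (vb b) = rho_coef i j b *: vb (rho_index i j b).
Proof.
by rewrite rhoT_basisE; case: i j => i [] j /=; rewrite ?scale0r ?scaleNr.
Qed.

Definition rhoE := (rhoT_linear1, rhoT_linear2, rhoT_linear3,
  @br_linear1 F (Aod F), @br_linear2 F (Aod F), @br_linear3 F (Aod F)).

Lemma rhoT_skew x y w : rho x y w = - rho y x w.
Proof.
have linN (M : lmodType F) (f : M -> V F) : linear f -> linear (fun u => - f u).
  by move=> lf a u v; rewrite lf opprD scalerN.
move: x; apply: freeg_linear_ext => [||i].
- exact: rhoT_linear1.
- exact/linN/rhoT_linear2.
move: y; apply: freeg_linear_ext => [||j].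
- exact: rhoT_linear2.
- exact/linN/rhoT_linear1.
move: w; apply: freeg_linear_ext => [||b].
- exact: rhoT_linear3.
- exact/linN/rhoT_linear3.
rewrite !rhoT_basisE.
by case: i j => i [] j /=; rewrite ?oppr0 ?opprK.
Qed.

Lemma rhoT_alt x w : rho x x w = 0.
Proof.
elim/freeg_ind_dom0: x => [|a i x _ _ IH].
  exact: linear_fun0 (rhoT_linear1 _ _).
rewrite freegUZ rhoT_linear1 !rhoT_linear2 IH addr0 [rho x _ _]rhoT_skew.
suff -> : rho << i >> << i >> w = 0.
  by rewrite scalerN scaler0 add0r subrr.
move: w {IH}; apply: freeg_linear_ext => [|a' u v|b].
- exact: rhoT_linear3.
- by rewrite scaler0 addr0.
- by rewrite rhoT_basisE; case: i.
Qed.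

(** Each case of an axiom on basis vectors has this form: the terms that do not
    vanish lie on a common line [F v_z]. *)
Lemma vb_colinear4 (z : F) (a b c d : F) (i j k l : F) :
  (a = 0 \/ i = z) -> (b = 0 \/ j = z) -> (c = 0 \/ k = z) ->
  (d = 0 \/ l = z) -> a = b + c + d ->
  a *: vb i = b *: vb j + c *: vb k + d *: vb l.
Proof.
have P (e : F) t : (e = 0 \/ t = z) -> e *: vb t = e *: vb z.
  by move=> [->|->]; rewrite ?scale0r.
by move=> /P-> /P-> /P-> /P-> ->; rewrite !scalerDl.
Qed.

Lemma rhoT_comm_basis i1 i2 i3 i4 b :
  let g i : Aod F := << i >> in
  rho (g i1) (g i2) (rho (g i3) (g i4) (vb b)) =
    rho (g i3) (g i4) (rho (g i1) (g i2) (vb b))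
    + rho (br (g i1) (g i2) (g i3)) (g i4) (vb b)
    + rho (g i3) (br (g i1) (g i2) (g i4)) (vb b).
Proof.
move=> g; rewrite /g {g} !(rho_vbE, br_basisE).
rewrite !(linear_funZ (rhoT_linear1 _ _), linear_funZ (rhoT_linear2 _ _),
          linear_funZ (rhoT_linear3 _ _)).
rewrite !rho_vbE !scalerA.
(* The common line is that of any term with a nonzero coefficient, so each of
   the four terms is tried. *)
case: i1 i2 i3 i4 => i1 [] i2 [] i3 [] i4 /=;
match goal with |- ?a *: vb ?i = ?b *: vb ?j + ?c *: vb ?k + ?d *: vb ?l =>
  let fin := solve [left; ring | right; ring | ring] in
  first [ solve [apply: (@vb_colinear4 i); fin]
        | solve [apply: (@vb_colinear4 j); fin]
        | solve [apply: (@vb_colinear4 k); fin]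
        | solve [apply: (@vb_colinear4 l); fin]]
end.
Qed.

Lemma rhoT_br_basis i1 i2 i3 i4 b :
  mu = 0 \/ mu = 1 ->
  let g i : Aod F := << i >> in
  rho (br (g i1) (g i2) (g i3)) (g i4) (vb b) =
    rho (g i1) (g i2) (rho (g i3) (g i4) (vb b))
    + rho (g i2) (g i3) (rho (g i1) (g i4) (vb b))
    + rho (g i3) (g i1) (rho (g i2) (g i4) (vb b)).
Proof.
move=> mu01 g; rewrite /g {g} !(rho_vbE, br_basisE).
rewrite !(linear_funZ (rhoT_linear1 _ _), linear_funZ (rhoT_linear2 _ _),
          linear_funZ (rhoT_linear3 _ _)).
rewrite !rho_vbE !scalerA.
case: i1 i2 i3 i4 => i1 [] i2 [] i3 [] i4 /=;
match goal with |- ?a *: vb ?i = ?b *: vb ?j + ?c *: vb ?k + ?d *: vb ?l =>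
  let fin := solve [left; ring | right; ring | ring
                   | by case: mu01 => ->; ring] in
  first [ solve [apply: (@vb_colinear4 i); fin]
        | solve [apply: (@vb_colinear4 j); fin]
        | solve [apply: (@vb_colinear4 k); fin]
        | solve [apply: (@vb_colinear4 l); fin]]
end.
Qed.

Lemma linear_sum3 a (A B C A' B' C' : V F) :
  (a *: A + A') + (a *: B + B') + (a *: C + C') =
    a *: (A + B + C) + (A' + B' + C').
Proof. by rewrite !scalerDr [a *: A + A' + _]addrACA [LHS]addrACA. Qed.

Lemma rhoT_comm x1 x2 x3 x4 w :
  rho x1 x2 (rho x3 x4 w) = rho x3 x4 (rho x1 x2 w)
    + rho (br x1 x2 x3) x4 w + rho x3 (br x1 x2 x4) w.
Proof.
move: x1; apply: freeg_linear_ext => [a u v|a u v|i1];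
  rewrite ?rhoE ?linear_sum3 //.
move: x2; apply: freeg_linear_ext => [a u v|a u v|i2];
  rewrite ?rhoE ?linear_sum3 //.
move: x3; apply: freeg_linear_ext => [a u v|a u v|i3];
  rewrite ?rhoE ?linear_sum3 //.
move: x4; apply: freeg_linear_ext => [a u v|a u v|i4];
  rewrite ?rhoE ?linear_sum3 //.
move: w; apply: freeg_linear_ext => [a u v|a u v|b];
  rewrite ?rhoE ?linear_sum3 //.
exact: rhoT_comm_basis.
Qed.

Lemma rhoT_br x1 x2 x3 x4 w :
  mu = 0 \/ mu = 1 ->
  rho (br x1 x2 x3) x4 w = rho x1 x2 (rho x3 x4 w)
    + rho x2 x3 (rho x1 x4 w) + rho x3 x1 (rho x2 x4 w).
Proof.
move=> mu01.
move: x1; apply: freeg_linear_ext => [a u v|a u v|i1];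
  rewrite ?rhoE ?linear_sum3 //.
move: x2; apply: freeg_linear_ext => [a u v|a u v|i2];
  rewrite ?rhoE ?linear_sum3 //.
move: x3; apply: freeg_linear_ext => [a u v|a u v|i3];
  rewrite ?rhoE ?linear_sum3 //.
move: x4; apply: freeg_linear_ext => [a u v|a u v|i4];
  rewrite ?rhoE ?linear_sum3 //.
move: w; apply: freeg_linear_ext => [a u v|a u v|b];
  rewrite ?rhoE ?linear_sum3 //.
exact: rhoT_br_basis.
Qed.

Lemma rhoT_LL0 r s w : rho (Lb F r) (Lb F s) w = 0.
Proof.
move: w; apply: freeg_linear_ext => [|a u v|b]; first exact: rhoT_linear3.
- by rewrite scaler0 addr0.
- exact: rhoT_LL.
Qed.

Lemma rhoT_is_module : is_module rho <-> mu = 0 \/ mu = 1.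
Proof.
split=> [[_ _ _ _ rbr]|mu01].
  (* Here p = 1, q = -1 and p' = q' = 0, so that p - p' = p' - q = 1. *)
  have := rbr (Lb F 0) (Lb F 1) (Mb F 0) (Mb F 1) (vb 0).
  have -> : br (Lb F 0) (Lb F 1) (Mb F 0) = Lb F 1.
    by rewrite br_LLM scale1r.
  rewrite [rho (Mb F 0) (Lb F 0) _]rhoT_skew rhoT_LL0 add0r.
  rewrite !rhoT_LM !(linear_funZ (rhoT_linear3 _ _)) !rhoT_LM !scalerA.
  move=> /(congr1 (coeff 0)).
  rewrite !(coeffD, coeffN, coeffZ, coeffU) !subrr !subr0 sub0r !addr0 !add0r.
  rewrite mulrN1z subrr eqxx !mulr1 !mul1r !mul0r !addr0 => E.
  have /eqP: mu * (1 - mu) = 0.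
    move/eqP: E; rewrite -subr_eq0 => /eqP E; rewrite -oppr0 -E; ring.
  by rewrite mulf_eq0 subr_eq0 eq_sym [1 == _]eq_sym => /orP[] /eqP; auto.
split.
- exact: rhoT_linear1.
- exact: rhoT_linear2.
- exact: rhoT_alt.
- move=> x1 x2 x3 x4 w; apply/eqP.
  by rewrite subr_eq rhoT_comm [eqbRHS]addrC addrA.
- by move=> *; exact: rhoT_br.
Qed.

End Action.

(** * Cosets of the integers *)

(** This weight lies outside the coset of 0, so that the whole module has a
    proper submodule. *)
Lemma half_not_inZ (F : fieldType) (char0 : [pchar F] =i pred0) :
  ~ inZ (2%:R^-1 : F).
Proof.
have nat0 := (pcharf0P F).1 char0.
have int0 (m : int) : m%:~R = 0 :> F -> m = 0.
  case: m => n; first by move/eqP; rewrite nat0 => /eqP ->.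
  by move/eqP; rewrite NegzE mulrNz oppr_eq0 nat0.
move=> [m mE]; have nz2 : 2%:R != 0 :> F by rewrite nat0.
have /int0 : (m * 2 - 1)%:~R = 0 :> F.
  by rewrite rmorphB rmorphM /= -mE mulVf ?subrr.
by case: m {mE} => n /=; lia.
Qed.

Section Cosets.
Variables (F : fieldType) (lam mu : F).
Local Notation rho := (rhoT lam mu).

Definition coset (alpha : F) : set F := [set alpha + m%:~R | m in [set: int]].

Definition punctured_coset (alpha : F) : set F :=
  [set alpha + m%:~R | m in [set m : int | m%:~R != - lam - alpha]].

Lemma U_supported alpha : U alpha = supported_on (coset alpha).
Proof. exact: lspan_vbE. Qed.

Lemma Ubar_supported alpha :
  Ubar lam alpha = supported_on (punctured_coset alpha).
Proof. exact: lspan_vbE. Qed.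

Lemma line_supported (b : F) : lspan [set vb b] = supported_on [set b].
Proof.
by have := lspan_vbE id [set b]; rewrite /= !image_set1.
Qed.

Lemma cosetD alpha b (n : int) : coset alpha b -> coset alpha (b + n%:~R).
Proof. by move=> [m _ <-]; exists (m + n) => //; rewrite rmorphD addrA. Qed.

Lemma coset_sub alpha b c :
  coset alpha b -> coset alpha c -> exists n : int, c = b + n%:~R.
Proof.
by move=> [m _ <-] [n _ <-]; exists (n - m); rewrite rmorphB /=; ring.
Qed.

(** The excluded index is the one that would give the weight [- lam]. *)
Lemma punctured_cosetE alpha b :
  punctured_coset alpha b <-> coset alpha b /\ lam + b != 0.
Proof.
have E m : (m%:~R != - lam - alpha) = (lam + (alpha + m%:~R) != 0).
  by rewrite -[in RHS](subr_eq0) subr0 addrA addrC -opprD addr_eq0.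
split=> [[m /= nz <-]|[[m _ <-] nz]]; last by exists m => //=; rewrite E.
by split; [exists m | rewrite -E].
Qed.

Lemma inZ_coset alpha : inZ (alpha + lam) <-> coset alpha (- lam).
Proof.
split=> [[m mE]|[m _ mE]]; exists (- m) => //.
  by rewrite rmorphN /= -mE; ring.
by rewrite rmorphN /= -[lam]opprK -mE; ring.
Qed.

Lemma U_submodule alpha : is_submodule rho (U alpha).
Proof.
rewrite U_supported; apply: supported_submodule => b n Pb _; exact: cosetD.
Qed.

Lemma line_submodule : mu = 0 -> is_submodule rho (supported_on [set - lam]).
Proof.
move=> ->; apply: supported_submodule => b n /= ->.
by rewrite mulr0 addr0 subrr eqxx.
Qed.

Lemma punctured_submodule alpha :
  mu = 1 -> is_submodule rho (supported_on (punctured_coset alpha)).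
Proof.
move=> ->; apply: supported_submodule => b n /punctured_cosetE[Pb _] nz.
by apply/punctured_cosetE; split; [exact: cosetD | rewrite addrA -[n%:~R]mulr1].
Qed.

Lemma punctured_irreducible alpha :
  mu = 1 -> irreducible rho (supported_on (punctured_coset alpha)).
Proof.
move=> ->; apply: supported_irreducible.
move=> b c /punctured_cosetE[Pb _] /punctured_cosetE[Pc nz].
have [n cE] := coset_sub Pb Pc; exists n => //.
by rewrite mulr1 -addrA -cE.
Qed.

(** Both possible values of the coefficient, [lam + b] at the source for
    [mu = 0] and [lam + c] at the target for [mu = 1], are nonzero on a coset
    that misses [- lam]. *)
Lemma U_irreducible alpha :
  mu = 0 \/ mu = 1 -> ~ inZ (alpha + lam) -> irreducible rho (U alpha).
Proof.
move=> mu01 nZ; rewrite U_supported; apply: supported_irreducible => b c Pb Pc.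
have nz d : coset alpha d -> lam + d != 0.
  move=> Pd; apply/eqP => /eqP; rewrite addrC addr_eq0 => /eqP dE.
  by apply/nZ/inZ_coset; rewrite -dE.
have [n cE] := coset_sub Pb Pc; exists n => //.
by case: mu01 => ->; rewrite ?mulr0 ?addr0 ?mulr1 -?addrA -?cE nz.
Qed.

(** The proper submodule is the line at [- lam] for [mu = 0], and the sum of all
    other lines of the coset for [mu = 1]; the weight [- lam + 1] separates the
    first from the coset and witnesses that the second is nonzero. *)
Lemma U_reducible alpha :
  mu = 0 \/ mu = 1 -> inZ (alpha + lam) -> ~ irreducible rho (U alpha).
Proof.
move=> mu01 /inZ_coset Pl; rewrite U_supported.
have Pl1 : coset alpha (- lam + 1) by exact: (cosetD 1).
have nz1 : lam + (- lam + 1) != 0 by rewrite addrA subrr add0r oner_eq0.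
case: mu01 => muE.
- apply: (supported_reducible (line_submodule muE) _ erefl Pl1) => [b ->|] //=.
  by move=> E; move: nz1; rewrite E subrr eqxx.
- apply: (supported_reducible (punctured_submodule alpha muE) _ _ Pl).
  + by move=> b /punctured_cosetE[].
  + by apply/punctured_cosetE; split; [exact: Pl1 |].
  + by move/punctured_cosetE => [_]; rewrite subrr eqxx.
Qed.

Lemma line_trivial x y w :
  mu = 0 -> supported_on [set - lam] w -> rho x y w = 0.
Proof.
move=> mu0 lw; pose S : set (V F) := [set 0].
have S0 : S 0 by [].
have Slin a u v : S u -> S v -> S (a *: u + v).
  by move=> -> ->; rewrite /S /= scaler0 addr0.
suff: S (rho x y w) by [].
apply: fglift_closed => // i _; apply: fglift_closed => // j _.
apply: fglift_closed => // b /lw ->; rewrite /S /= mu0.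
by case: i j => i [] j //=; rewrite mulr0 addr0 subrr scale0r ?oppr0.
Qed.

End Cosets.

Unset Implicit Arguments.

Theorem theorem3p1 (F : fieldType) (char0 : [pchar F] =i pred0) (lam mu : F) :
  (is_module (rhoT lam mu) <-> (mu = 0 \/ mu = 1)) /\
  (mu = 0 \/ mu = 1 ->
     (reducible_module (rhoT lam mu) /\
        forall alpha : F, is_submodule (rhoT lam mu) (U alpha)) /\
     (mu = 0 ->
        trivial_submodule_of (rhoT lam mu)
          (lspan [set vb (- lam)]) (U (- lam))) /\
     (mu = 1 -> forall alpha : F, inZ (alpha + lam) ->
        submodule_of (rhoT lam mu) (Ubar lam alpha) (U alpha) /\
        irreducible (rhoT lam mu) (Ubar lam alpha)) /\
     (forall alpha : F,
        irreducible (rhoT lam mu) (U alpha) <-> ~ inZ (alpha + lam))).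
Proof.
split; first exact: rhoT_is_module.
move=> mu01; split.
  split; last exact: U_submodule.
  split; first exact/rhoT_is_module.
  have -> : [set: V F] = supported_on [set: F] by apply/seteqP.
  apply: (@supported_reducible _ _ _ _ (coset 0) 0 2%:R^-1) => //.
  - by rewrite -U_supported; exact: U_submodule.
  - by exists 0 => //; rewrite addr0.
  - move=> [m _ mE]; apply: (half_not_inZ char0).
    by exists m; rewrite -mE add0r.
split.
  move=> mu0; rewrite line_supported; split; last first.
    by move=> x y w; exact: line_trivial.
  split; first exact: line_submodule.
  by rewrite U_supported; apply: supportedS => _ ->; exists 0; rewrite ?addr0.
split.
  move=> mu1 alpha _; rewrite Ubar_supported.
  split; last exact: punctured_irreducible.
  split; first exact: punctured_submodule.
  by rewrite U_supported; apply: supportedS => b /punctured_cosetE[].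
move=> alpha; split; last exact: U_irreducible.
by move=> irr; move/(U_reducible mu01); exact.
Qed.
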